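(* Let $\mathbb{S}_{\mathfrak{D}}=\sum_{\sigma\in\mathfrak{D}}\sigma\in\mathbb{C}\mathfrak{D}$ be the group symmetrizer. Then $P=\mathbb{S}_{\mathfrak{D}}(p)-3$ and $Q=\mathbb{S}_{\mathfrak{D}}(q)+9$, where $$p=\tfrac18\big(t_{(1)}t_{(-1)}t_{(2)}t_{(-2)}-4t_{(1)}t_{(-2)}t_{(-4)}+2t_{(1)}t_{(-1)}+2t_{(3)}t_{(-3)}\big)$$ and $$\begin{aligned} q=\tfrac18\big(&2t_{(-2)}t_{(-1)}^2t_{(1)}^2t_{(2)}+4t_{(1)}^2t_{(2)}^2t_{(3)}-4t_{(1)}^3t_{(-2)}t_{(2)}-8t_{(-4)}t_{(-2)}t_{(-1)}t_{(1)}^2\\ &-4t_{(4)}t_{(3)}t_{(2)}t_{(1)}t_{(-2)}+8t_{(1)}t_{(3)}t_{(-4)}^2+8t_{(-4)}t_{(1)}t_{(2)}^2-8t_{(3)}^2t_{(2)}t_{(1)}\\ &+4t_{(4)}t_{(-3)}t_{(2)}^2+t_{(-2)}t_{(-1)}t_{(2)}t_{(1)}+t_{(-3)}t_{(-4)}t_{(3)}t_{(4)}+4t_{(-3)}t_{(-1)}t_{(3)}t_{(1)}\\ &+4t_{(1)}^3+4t_{(3)}^3+12t_{(-4)}t_{(-2)}t_{(1)}-12t_{(-4)}t_{(2)}t_{(3)}-12t_{(1)}t_{(-1)}-12t_{(3)}t_{(-3)}\big). \end{aligned}$$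
   Context: Let $G=\mathrm{SL}(3,\mathbb{C})$ and $\mathbb{C}[\mathfrak{X}]=\mathbb{C}[G\times G]^G$ (invariants for simultaneous conjugation), with $\mathbf{x}_1,\mathbf{x}_2$ the two coordinate matrices. Put $t_{(1)}=\mathrm{tr}(\mathbf{x}_1)$, $t_{(-1)}=\mathrm{tr}(\mathbf{x}_1^{-1})$, $t_{(2)}=\mathrm{tr}(\mathbf{x}_2)$, $t_{(-2)}=\mathrm{tr}(\mathbf{x}_2^{-1})$, $t_{(3)}=\mathrm{tr}(\mathbf{x}_1\mathbf{x}_2)$, $t_{(-3)}=\mathrm{tr}(\mathbf{x}_1^{-1}\mathbf{x}_2^{-1})$, $t_{(4)}=\mathrm{tr}(\mathbf{x}_1\mathbf{x}_2^{-1})$, $t_{(-4)}=\mathrm{tr}(\mathbf{x}_1^{-1}\mathbf{x}_2)$. These eight elements are algebraically independent and generate the polynomial subring $R\subset\mathbb{C}[\mathfrak{X}]$. $\mathrm{Out}(\mathtt{F}_2)$, $\mathtt{F}_2=\langle\mathtt{x}_1,\mathtt{x}_2\rangle$, acts on $\mathbb{C}[\mathfrak{X}]$ by algebra automorphisms via $\alpha\cdot\mathrm{tr}(\mathbf{w})=\mathrm{tr}(\alpha(\mathbf{w}))$, where $\mathbf{w}$ is the word $\mathtt{w}$ evaluated at $\mathtt{x}_i\mapsto\mathbf{x}_i$. $\mathfrak{D}\subset\mathrm{Out}(\mathtt{F}_2)$ is the subgroup (of order $8$) generated by $\tau:\mathtt{x}_1\leftrightarrow\mathtt{x}_2$ and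 $\iota:\mathtt{x}_1\mapsto\mathtt{x}_1^{-1},\mathtt{x}_2\mapsto\mathtt{x}_2$. It preserves $R$: $\tau$ swaps $t_{(1)}\leftrightarrow t_{(2)}$, $t_{(-1)}\leftrightarrow t_{(-2)}$, $t_{(4)}\leftrightarrow t_{(-4)}$ and fixes $t_{(\pm3)}$; $\iota$ swaps $t_{(1)}\leftrightarrow t_{(-1)}$, $t_{(3)}\leftrightarrow t_{(-4)}$, $t_{(-3)}\leftrightarrow t_{(4)}$ and fixes $t_{(\pm2)}$. The group ring $\mathbb{C}\mathfrak{D}$ acts linearly. The elements $P,Q\in R$ are $$\begin{aligned}P=&\,t_{(1)}t_{(-1)}t_{(2)}t_{(-2)}-t_{(1)}t_{(2)}t_{(-3)}-t_{(-1)}t_{(-2)}t_{(3)}-t_{(1)}t_{(-2)}t_{(-4)}-t_{(-1)}t_{(2)}t_{(4)}\\&+t_{(1)}t_{(-1)}+t_{(2)}t_{(-2)}+t_{(3)}t_{(-3)}+t_{(4)}t_{(-4)}-3,\end{aligned}$$ $$\begin{aligned} Q=&\,9-6t_{(1)}t_{(-1)}-6t_{(2)}t_{(-2)}-6t_{(3)}t_{(-3)}-6t_{(4)}t_{(-4)}+t_{(1)}^3+t_{(2)}^3+t_{(3)}^3+t_{(4)}^3\\ &+t_{(-1)}^3+t_{(-2)}^3+t_{(-3)}^3+t_{(-4)}^3-3t_{(-4)}t_{(-3)}t_{(-1)}-3t_{(4)}t_{(3)}t_{(1)}\\ &-3t_{(-4)}t_{(2)}t_{(3)}-3t_{(4)}t_{(-2)}t_{(-3)}+3t_{(-4)}t_{(-2)}t_{(1)}+3t_{(4)}t_{(2)}t_{(-1)}\\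 &+3t_{(1)}t_{(2)}t_{(-3)}+3t_{(-1)}t_{(-2)}t_{(3)}+t_{(-2)}t_{(-1)}t_{(2)}t_{(1)}+t_{(-3)}t_{(-2)}t_{(3)}t_{(2)}\\ &+t_{(-4)}t_{(-1)}t_{(4)}t_{(1)}+t_{(-4)}t_{(-2)}t_{(4)}t_{(2)}+t_{(-3)}t_{(-1)}t_{(3)}t_{(1)}+t_{(-3)}t_{(-4)}t_{(3)}t_{(4)}\\ &+t_{(-4)}^2t_{(-3)}t_{(-2)}+t_{(4)}^2t_{(3)}t_{(2)}+t_{(-1)}^2t_{(-2)}t_{(-4)}+t_{(1)}^2t_{(2)}t_{(4)}\\ &+t_{(1)}t_{(-2)}^2t_{(-3)}+t_{(-1)}t_{(2)}^2t_{(3)}+t_{(-4)}t_{(-3)}t_{(1)}^2+t_{(4)}t_{(3)}t_{(-1)}^2\\ &+t_{(-4)}t_{(2)}t_{(-3)}^2+t_{(4)}t_{(-2)}t_{(3)}^2+t_{(-1)}^2t_{(-3)}t_{(2)}+t_{(1)}^2t_{(3)}t_{(-2)}\\ &+t_{(-4)}t_{(1)}t_{(2)}^2+t_{(4)}t_{(-1)}t_{(-2)}^2+t_{(-4)}t_{(3)}t_{(-2)}^2+t_{(4)}t_{(-3)}t_{(2)}^2\\ &+t_{(1)}t_{(3)}t_{(-4)}^2+t_{(-1)}t_{(-3)}t_{(4)}^2+t_{(-1)}t_{(-4)}t_{(3)}^2+t_{(1)}t_{(4)}t_{(-3)}^2-2t_{(-3)}^2t_{(-2)}t_{(-1)}\\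 &-2t_{(3)}^2t_{(2)}t_{(1)}-2t_{(-4)}^2t_{(-1)}t_{(2)}-2t_{(4)}^2t_{(1)}t_{(-2)}+t_{(-1)}^2t_{(-2)}^2t_{(-3)}+t_{(1)}^2t_{(2)}^2t_{(3)}\\ &+t_{(-4)}t_{(-1)}^2t_{(2)}^2+t_{(4)}t_{(1)}^2t_{(-2)}^2-t_{(-4)}t_{(-2)}^2t_{(2)}t_{(1)}-t_{(4)}t_{(2)}^2t_{(-2)}t_{(-1)}\\ &-t_{(-3)}t_{(1)}^2t_{(-1)}t_{(2)}-t_{(3)}t_{(-1)}^2t_{(1)}t_{(-2)}-t_{(-3)}t_{(2)}^2t_{(-2)}t_{(1)}-t_{(3)}t_{(-2)}^2t_{(2)}t_{(-1)}\\ &-t_{(-4)}t_{(-2)}t_{(-1)}t_{(1)}^2-t_{(4)}t_{(2)}t_{(1)}t_{(-1)}^2-t_{(-1)}t_{(-2)}^3t_{(1)}-t_{(-1)}t_{(2)}^3t_{(1)}\\ &-t_{(-1)}^3t_{(-2)}t_{(2)}-t_{(1)}^3t_{(-2)}t_{(2)}-t_{(-4)}t_{(-3)}t_{(-2)}t_{(-1)}t_{(2)}-t_{(4)}t_{(3)}t_{(2)}t_{(1)}t_{(-2)}\\ &-t_{(-1)}t_{(1)}t_{(2)}t_{(-4)}t_{(3)}-t_{(-1)}t_{(1)}t_{(-2)}t_{(4)}t_{(-3)}+t_{(-2)}t_{(-1)}^2t_{(1)}^2t_{(2)}+t_{(-1)}t_{(-2)}^2t_{(2)}^2t_{(1)}.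 \end{aligned}$$ *)

(* Defs.v *)
From HB Require Import structures.
From mathcomp Require Import all_boot all_order all_algebra.
From mathcomp Require Import finmap boolp classical_sets functions cardinality fsbigop.
From mathcomp Require Import reals complex.

Set Implicit Arguments.
Unset Strict Implicit.
Unset Printing Implicit Defensive.

Import GRing.Theory.
Local Open Scope ring_scope.

(* Automorphisms carry their inverse; by [autgP] they are nonetheless
   determined by the underlying function. *)
Record autg (G : groupType) := Autg {
  autg_fun :> G -> G;
  autg_inv : G -> G;
  autgM : {morph autg_fun : x y / (x * y)%g >-> (x * y)%g};
  autgK : cancel autg_fun autg_inv;
  autgVK : cancel autg_inv autg_fun }.

Section AutOut.
Local Open Scope group_scope.
Variable G : groupType.
Implicit Types (x y : G) (a b c : autg G).

Lemma autgP a b : a =1 b -> a = b.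
Proof.
case: a b => [f f' fM fK f'K] [g g' gM gK g'K] /= /funext fg; subst g.
have /funext E : f' =1 g' by move=> x; rewrite -{1}(g'K x) fK.
subst g'; congr Autg; exact: Prop_irrelevance.
Qed.

HB.instance Definition _ := gen_eqMixin (autg G).
HB.instance Definition _ := gen_choiceMixin (autg G).

Definition autg1 : autg G := @Autg G id id (fun _ _ => erefl) (fun _ => erefl) (fun _ => erefl).

Fact autg_invM a : {morph autg_inv a : x y / x * y >-> x * y}.
Proof. by move=> x y; apply: (can_inj (@autgK _ a)); rewrite autgM !autgVK. Qed.

Definition autgV a : autg G := Autg (@autg_invM a) (@autgVK _ a) (@autgK _ a).

Fact autg_mulM a b : {morph a \o b : x y / x * y >-> x * y}.
Proof. by move=> x y /=; rewrite !autgM. Qed.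

Definition autg_mul a b : autg G :=
  Autg (@autg_mulM a b)
    (can_comp (@autgK _ a) (@autgK _ b)) (can_comp (@autgVK _ b) (@autgVK _ a)).

Fact autg_mulA : associative autg_mul. Proof. by move=> a b c; apply: autgP. Qed.
Fact autg_mul1 : left_id autg1 autg_mul. Proof. by move=> a; apply: autgP. Qed.
Fact autg_mulr1 : right_id autg1 autg_mul. Proof. by move=> a; apply: autgP. Qed.
Fact autg_mulV : left_inverse autg1 autgV autg_mul.
Proof. by move=> a; apply: autgP => x /=; rewrite autgK. Qed.
Fact autg_mulrV : right_inverse autg1 autgV autg_mul.
Proof. by move=> a; apply: autgP => x /=; rewrite autgVK. Qed.

HB.instance Definition _ := isGroup.Build (autg G)
  autg_mulA autg_mul1 autg_mulr1 autg_mulV autg_mulrV.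

Lemma autg_mulE a b x : (a * b) x = a (b x). Proof. by []. Qed.

Fact inng_M x : {morph (fun y => x * y * x^-1) : y z / y * z >-> y * z}.
Proof. by move=> y z; rewrite !mulgA mulgVK. Qed.
Fact inng_K x : cancel (fun y => x * y * x^-1) (fun y => x^-1 * y * x).
Proof. by move=> y; rewrite !mulgA mulVg mul1g mulgVK. Qed.
Fact inng_VK x : cancel (fun y => x^-1 * y * x) (fun y => x * y * x^-1).
Proof. by move=> y; rewrite !mulgA mulgV mul1g mulgK. Qed.

Definition inng x : autg G := Autg (@inng_M x) (@inng_K x) (@inng_VK x).

Definition out_eq a b : bool := `[< exists x, a = inng x * b >].

Lemma inng1 : inng 1 = 1.
Proof. by apply: autgP => y /=; rewrite mul1g invg1 mulg1. Qed.

Lemma inng_mul x y : inng x * inng y = inng (x * y).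
Proof. by apply: autgP => z; rewrite autg_mulE /= invgM !mulgA. Qed.

Lemma autg_inng a x : a * inng x = inng (a x) * a.
Proof.
apply: autgP => z; rewrite !autg_mulE /= !autgM; congr (_ * _).
have a1 : a 1 = 1 by apply: (mulgI (a 1)); rewrite -autgM !mulg1.
by apply: (mulgI (a x)); rewrite -autgM !mulgV.
Qed.

Fact out_eq_refl : reflexive out_eq.
Proof. by move=> a; apply/asboolP; exists 1; rewrite inng1 mul1g. Qed.
Fact out_eq_sym : symmetric out_eq.
Proof.
move=> a b; apply/asboolP/asboolP => -[x ->]; exists x^-1;
  by rewrite mulgA inng_mul mulVg inng1 mul1g.
Qed.
Fact out_eq_trans : transitive out_eq.
Proof.
move=> b a c /asboolP[x ->] /asboolP[y ->]; apply/asboolP; exists (x * y).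
by rewrite mulgA inng_mul.
Qed.

Canonical out_equiv := EquivRel out_eq out_eq_refl out_eq_sym out_eq_trans.

Definition outg := {eq_quot out_equiv}%qT.

HB.instance Definition _ := EqQuotient.on outg.
HB.instance Definition _ := Choice.on outg.

Definition outc (a : autg G) : outg := \pi_outg%qT a.

Lemma outcP a b : reflect (exists x, a = inng x * b) (outc a == outc b).
Proof. by rewrite /outc eqmodE; exact: asboolP. Qed.

Definition outg_mul (u v : outg) : outg := outc (repr u * repr v)%g.
Definition outg_inv (u : outg) : outg := outc (repr u)^-1%g.

Lemma outcK u : outc (repr u) = u. Proof. exact: reprK. Qed.

Lemma outc_repr a : exists x, repr (outc a) = inng x * a.
Proof. by apply/outcP; rewrite outcK. Qed.

Lemma outg_mulE a b : outg_mul (outc a) (outc b) = outc (a * b).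
Proof.
rewrite /outg_mul; have [x ->] := outc_repr a; have [y ->] := outc_repr b.
apply/eqP/outcP; exists (x * a y).
by rewrite -inng_mul -!mulgA; congr (_ * _); rewrite !mulgA autg_inng.
Qed.

Lemma outg_invE a : outg_inv (outc a) = outc a^-1.
Proof.
rewrite /outg_inv; have [x ->] := outc_repr a.
apply/eqP/outcP; exists (a^-1 x^-1); rewrite -autg_inng invgM; congr (_ * _).
by apply: (mulgI (inng x)); rewrite inng_mul !mulgV inng1.
Qed.

Fact outg_mulA : associative outg_mul.
Proof.
by move=> u v w; rewrite -(outcK u) -(outcK v) -(outcK w) !outg_mulE mulgA.
Qed.
Fact outg_mul1 : left_id (outc 1) outg_mul.
Proof. by move=> u; rewrite -(outcK u) outg_mulE mul1g. Qed.
Fact outg_mulr1 : right_id (outc 1) outg_mul.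
Proof. by move=> u; rewrite -(outcK u) outg_mulE mulg1. Qed.
Fact outg_mulV : left_inverse (outc 1) outg_inv outg_mul.
Proof. by move=> u; rewrite -(outcK u) outg_invE outg_mulE mulVg. Qed.
Fact outg_mulrV : right_inverse (outc 1) outg_inv outg_mul.
Proof. by move=> u; rewrite -(outcK u) outg_invE outg_mulE mulgV. Qed.

HB.instance Definition _ := isGroup.Build outg
  outg_mulA outg_mul1 outg_mulr1 outg_mulV outg_mulrV.

Lemma outcM a b : outc (a * b) = outc a * outc b.
Proof. by rewrite -outg_mulE. Qed.

End AutOut.

Definition is_subgroup (G : groupType) (H : set G) : Prop :=
  H 1%g /\ forall x y, H x -> H y -> H (x * y^-1)%g.

Definition subgroup_gen (G : groupType) (A : set G) : set G :=
  smallest (@is_subgroup G) A.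

(* A letter (g, e) is the generator x_1 (g = false) or x_2 (g = true), inverted
   when e = true.  F_2 is realized on the freely reduced words. *)
Definition letter := (bool * bool)%type.
Definition letterV (l : letter) : letter := (l.1, ~~ l.2).

Section Free.

Definition reduced (w : seq letter) : bool :=
  sorted [rel k l | l != letterV k] w.

Definition push (l : letter) (w : seq letter) : seq letter :=
  if w is k :: w' then if k == letterV l then w' else l :: w else [:: l].

Definition reduce (w : seq letter) : seq letter := foldr push [::] w.

Lemma letterVK : involutive letterV. Proof. by case=> ? [] . Qed.

Lemma push_reduced l w : reduced w -> reduced (push l w).
Proof.
case: w => [|k w] //= kw; case: ifPn => [_|kl]; first exact: path_sorted kw.
by rewrite /reduced /= kl.
Qed.

Lemma pushK l w : reduced w -> push (letterV l) (push l w) = w.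
Proof.
case: w => [|k w] /=; first by rewrite letterVK eqxx.
case: eqP => [-> /=|_ _ /=]; last by rewrite letterVK eqxx.
case: w => [|m w] //= /andP[/= ml _].
by rewrite (negPf ml).
Qed.

Lemma reduce_reduced w : reduced (reduce w).
Proof. by elim: w => //= l w; apply: push_reduced. Qed.

Lemma reduce_id w : reduced w -> reduce w = w.
Proof.
elim: w => //= l w IH lw; rewrite (IH (path_sorted lw)).
by case: w lw {IH} => //= k w /andP[/= /negPf->].
Qed.

Lemma foldr_push_reduced u v : reduced v -> reduced (foldr push v u).
Proof. by move=> rv; elim: u => //= l u; apply: push_reduced. Qed.

Lemma foldr_pushK l u v : reduced v ->
  foldr push v (push l u) = push l (foldr push v u).
Proof.
move=> rv; case: u => [|k u] //=; case: eqP => [->|] //.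
have := pushK (letterV l) (foldr_push_reduced u rv).
by rewrite letterVK /= => ->.
Qed.

Lemma foldr_reduce u v : reduced v -> foldr push v (reduce u) = foldr push v u.
Proof. by move=> rv; elim: u => //= l u <-; rewrite foldr_pushK. Qed.

Lemma reduce_cat u v : reduce (u ++ v) = foldr push (reduce v) u.
Proof. by rewrite /reduce foldr_cat. Qed.

End Free.

Record F2 := FreeWord { word :> seq letter; wordP : reduced word }.
HB.instance Definition _ := [isSub for word].
HB.instance Definition _ := [Choice of F2 by <:].

Definition f2_of (w : seq letter) : F2 := FreeWord (reduce_reduced w).
Definition f2_mul (u v : F2) : F2 := f2_of (word u ++ word v).
Definition f2_one : F2 := @FreeWord [::] isT.
Definition f2_inv (u : F2) : F2 := f2_of (rev (map letterV (word u))).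

Fact f2_mulA : associative f2_mul.
Proof.
move=> u v w; apply: val_inj.
rewrite -[LHS]/(reduce (u ++ reduce (v ++ w))).
rewrite -[RHS]/(reduce (reduce (u ++ v) ++ w)).
rewrite !(reduce_cat _ w) (reduce_cat u) foldr_reduce ?reduce_reduced //.
by rewrite foldr_cat reduce_id // foldr_push_reduced ?reduce_reduced.
Qed.
Fact f2_mul1 : left_id f2_one f2_mul.
Proof. by move=> u; apply: val_inj; rewrite /= reduce_id ?wordP. Qed.
Fact f2_mulr1 : right_id f2_one f2_mul.
Proof. by move=> u; apply: val_inj; rewrite /= cats0 reduce_id ?wordP. Qed.
Fact f2_mulV : left_inverse f2_one f2_inv f2_mul.
Proof.
move=> u; apply: val_inj => /=.
rewrite !reduce_cat foldr_reduce ?reduce_reduced // reduce_id ?wordP //.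
elim: (word u) (wordP u) => [|l w IH] //= lw.
have rw := path_sorted lw.
rewrite rev_cons foldr_rcons /= letterVK eqxx; exact: IH.
Qed.
Fact f2_mulrV : right_inverse f2_one f2_inv f2_mul.
Proof.
move=> u; rewrite -[LHS]f2_mul1 -{1}(f2_mulV (f2_inv u)) -f2_mulA.
by rewrite (f2_mulA _ u) f2_mulV f2_mul1 f2_mulV.
Qed.

HB.instance Definition _ := isGroup.Build F2
  f2_mulA f2_mul1 f2_mulr1 f2_mulV f2_mulrV.

Definition x1 : F2 := @FreeWord [:: (false, false)] isT.
Definition x2 : F2 := @FreeWord [:: (true, false)] isT.

Section Eval.
Local Open Scope group_scope.
Variable H : groupType.
Implicit Types (A : H * H).

Definition letter_ev A (l : letter) : H :=
  let h := if l.1 then A.2 else A.1 in if l.2 then h^-1 else h.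

Definition seq_ev A (w : seq letter) : H :=
  foldr (fun l h => letter_ev A l * h) 1 w.

Definition word_ev A (w : F2) : H := seq_ev A (word w).

Lemma letter_evV A l : letter_ev A (letterV l) = (letter_ev A l)^-1.
Proof. by case: l => g [] //=; rewrite /letter_ev /= invgK. Qed.

Lemma seq_ev_push A l w : seq_ev A (push l w) = letter_ev A l * seq_ev A w.
Proof.
case: w => [|k w] //=; case: eqP => [->|] //=.
by rewrite letter_evV mulgA mulgV mul1g.
Qed.

Lemma seq_ev_reduce A w : seq_ev A (reduce w) = seq_ev A w.
Proof. by elim: w => //= l w IH; rewrite seq_ev_push IH. Qed.

Lemma seq_ev_cat A u v : seq_ev A (u ++ v) = seq_ev A u * seq_ev A v.
Proof. by elim: u => [|l u IH] /=; rewrite ?mul1g // IH mulgA. Qed.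

Lemma word_evM A : {morph word_ev A : u v / u * v >-> u * v}.
Proof. by move=> u v; rewrite /word_ev /= seq_ev_reduce seq_ev_cat. Qed.

Lemma word_ev1 A : word_ev A x1 = A.1. Proof. exact: mulg1. Qed.
Lemma word_ev2 A : word_ev A x2 = A.2. Proof. exact: mulg1. Qed.

Lemma word_evV A w : word_ev A w^-1 = (word_ev A w)^-1.
Proof. by apply: (mulgI (word_ev A w)); rewrite -word_evM !mulgV. Qed.

Lemma word_ev_uniq (f : F2 -> H) : {morph f : u v / u * v >-> u * v} ->
  f =1 word_ev (f x1, f x2).
Proof.
move=> fM u.
have f1 : f 1 = 1 by apply: (mulgI (f 1)); rewrite -fM !mulg1.
have fV v : f v^-1 = (f v)^-1 by apply: (mulgI (f v)); rewrite -fM !mulgV.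
suff E w : f (f2_of w) = seq_ev (f x1, f x2) w.
  rewrite /word_ev -E; congr f; apply: val_inj.
  by rewrite /= reduce_id ?wordP.
elim: w => [|l w IH] /=; first by rewrite -f1; congr f; apply: val_inj.
have -> : f2_of (l :: w) = f2_of [:: l] * f2_of w.
  apply: val_inj; rewrite -[RHS]/(reduce ([:: l] ++ reduce w)).
  by rewrite reduce_cat (reduce_id (reduce_reduced w)).
rewrite fM IH; congr (_ * _); case: l => [[] []]; rewrite /letter_ev /=.
- by rewrite -fV; congr f; apply: val_inj.
- by congr f; apply: val_inj.
- by rewrite -fV; congr f; apply: val_inj.
- by congr f; apply: val_inj.
Qed.

End Eval.

Section Involutions.
Local Open Scope group_scope.
Variable A : F2 * F2.
Hypothesis A1 : word_ev A A.1 = x1.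
Hypothesis A2 : word_ev A A.2 = x2.

Fact involutionK : cancel (word_ev A) (word_ev A).
Proof.
move=> w; pose f := word_ev A \o word_ev A.
have fM : {morph f : u v / u * v >-> u * v}.
  by move=> u v; rewrite /f /= !word_evM.
rewrite -[LHS]/(f w) (word_ev_uniq fM) /f /= !(word_ev1, word_ev2) A1 A2.
by rewrite -[RHS]/(idfun w) (@word_ev_uniq _ idfun).
Qed.

Definition involution : autg F2 :=
  Autg (@word_evM _ A) involutionK involutionK.

End Involutions.

Fact tau_1 : word_ev (x2, x1) x2 = x1. Proof. exact: word_ev2. Qed.
Fact tau_2 : word_ev (x2, x1) x1 = x2. Proof. exact: word_ev1. Qed.
Definition tau_aut : autg F2 := @involution (x2, x1) tau_1 tau_2.

Fact iota_1 : word_ev (x1^-1%g, x2) x1^-1%g = x1.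
Proof. by rewrite word_evV word_ev1 invgK. Qed.
Fact iota_2 : word_ev (x1^-1%g, x2) x2 = x2. Proof. exact: word_ev2. Qed.
Definition iota_aut : autg F2 := @involution (x1^-1%g, x2) iota_1 iota_2.

Definition frakD : set (outg F2) :=
  subgroup_gen [set outc tau_aut; outc iota_aut].

Section FiniteD.
Local Open Scope group_scope.

Let lt (g e : bool) : F2 :=
  let x := if g then x2 else x1 in if e then x^-1 else x.

Let signed (t : bool * bool * bool) (a : autg F2) : Prop :=
  a x1 = lt t.1.1 t.1.2 /\ a x2 = lt (~~ t.1.1) t.2.

Let autg_eq (a b : autg F2) : a x1 = b x1 -> a x2 = b x2 -> a = b.
Proof.
move=> ab1 ab2; apply: autgP => w.
by rewrite (word_ev_uniq (@autgM _ a)) (word_ev_uniq (@autgM _ b)) ab1 ab2.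
Qed.

Let autg_invE (a : autg F2) u : a u^-1 = (a u)^-1.
Proof.
have a1 : a 1 = 1 by apply: (mulgI (a 1)); rewrite -autgM !mulg1.
by apply: (mulgI (a u)); rewrite -autgM !mulgV.
Qed.

Let signed_lt t a g e : signed t a ->
  a (lt g e) = lt (g (+) t.1.1) (e (+) if g then t.2 else t.1.2).
Proof.
case: t => [[s e1] e2] [/= a1 a2]; rewrite /lt.
case: g; case: e => /=; rewrite ?autg_invE ?a1 ?a2 /lt;
  by case: s {a1 a2}; case: e1; case: e2 => /=; rewrite ?invgK.
Qed.

Let signedM t u a b : signed t a -> signed u b -> exists v, signed v (a * b).
Proof.
move=> ta [b1 b2]; case: u b1 b2 => [[s e1] e2] /= b1 b2.
exists (s (+) t.1.1, e1 (+) (if s then t.2 else t.1.2),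
        e2 (+) (if ~~ s then t.2 else t.1.2)).
by rewrite /signed !autg_mulE b1 b2 !(signed_lt _ _ ta) /= addNb.
Qed.

Let signedV t a : signed t a -> exists v, signed v a^-1.
Proof.
move=> ta; case: (t) ta => [[s e1] e2] ta.
exists (s, if s then e2 else e1, if s then e1 else e2).
split; apply: (can_inj (@autgK _ a)); rewrite [LHS]autgVK (signed_lt _ _ ta) /=;
  by case: s {ta}; case: e1; case: e2.
Qed.

Lemma finite_frakD : finite_set frakD.
Proof.
pose S : set (outg F2) := [set u | exists t a, signed t a /\ u = outc a]%classic.
have DS : (frakD `<=` S)%classic.
  apply: smallest_sub; last first.
    move=> u [->|->].
    - by exists (true, false, false), tau_aut; split; first split;
        rewrite /= ?word_ev1 ?word_ev2.
    - by exists (false, true, false), iota_aut; split; first split;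
        rewrite /= ?word_ev1 ?word_ev2.
  split; first by exists (false, false, false), 1.
  move=> _ _ [t [a [ta ->]]] [u [b [ub ->]]].
  have [v vb] := signedV ub; have [w wab] := signedM ta vb.
  by exists w, (a * b^-1); split; last by rewrite -outg_mulE -outg_invE.
apply: sub_finite_set DS _.
pose F t := outc (xget 1 [set a | signed t a]%classic).
apply: (@sub_finite_set _ _ (F @` [set: bool * bool * bool])%classic); last first.
  by apply: finite_image; exact: finite_finset.
move=> _ [t [a [ta ->]]]; exists t => //; rewrite /F; congr outc.
have [c1 c2] : signed t (xget 1 [set a | signed t a]%classic) by exact: (@xgetPex _ 1 _ (ex_intro _ a ta)).
case: ta => a1 a2.
by apply: autg_eq; rewrite ?c1 ?c2.
Qed.

End FiniteD.

Section CharacterVariety.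
Variable K : fieldType.

Record sl3 := Sl3 { sl3_mx :> 'M[K]_3; sl3P : \det sl3_mx == 1 }.
HB.instance Definition _ := [isSub for sl3_mx].
HB.instance Definition _ := [Choice of sl3 by <:].

Fact sl3_mulP (A B : sl3) : \det (A *m B) == 1.
Proof. by rewrite det_mulmx (eqP (sl3P A)) (eqP (sl3P B)) mulr1. Qed.
Fact sl3_oneP : \det (1%:M : 'M[K]_3) == 1.
Proof. by rewrite det1. Qed.
Fact sl3_unit (A : sl3) : sl3_mx A \in unitmx.
Proof. by rewrite unitmxE (eqP (sl3P A)) unitr1. Qed.
Fact sl3_invP (A : sl3) : \det (invmx A) == 1.
Proof. by rewrite det_inv (eqP (sl3P A)) invr1. Qed.

Definition sl3_mul (A B : sl3) : sl3 := Sl3 (sl3_mulP A B).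
Definition sl3_one : sl3 := Sl3 sl3_oneP.
Definition sl3_inv (A : sl3) : sl3 := Sl3 (sl3_invP A).

Fact sl3_mulA : associative sl3_mul.
Proof. by move=> A B C; apply: val_inj; rewrite /= mulmxA. Qed.
Fact sl3_mul1 : left_id sl3_one sl3_mul.
Proof. by move=> A; apply: val_inj; rewrite /= mul1mx. Qed.
Fact sl3_mulr1 : right_id sl3_one sl3_mul.
Proof. by move=> A; apply: val_inj; rewrite /= mulmx1. Qed.
Fact sl3_mulV : left_inverse sl3_one sl3_inv sl3_mul.
Proof. by move=> A; apply: val_inj; rewrite /= mulVmx ?sl3_unit. Qed.
Fact sl3_mulrV : right_inverse sl3_one sl3_inv sl3_mul.
Proof. by move=> A; apply: val_inj; rewrite /= mulmxV ?sl3_unit. Qed.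

HB.instance Definition _ := isGroup.Build sl3
  sl3_mulA sl3_mul1 sl3_mulr1 sl3_mulV sl3_mulrV.

Local Notation GG := (sl3 * sl3)%type.

(* The polynomial functions in the entries of the two matrices; over an
   algebraically closed K they form the coordinate ring K[G x G]. *)
Inductive regular : (GG -> K) -> Prop :=
| regular_cst c : regular (fun=> c)
| regular_fst i j : regular (fun A => sl3_mx A.1 i j)
| regular_snd i j : regular (fun A => sl3_mx A.2 i j)
| regular_add f g : regular f -> regular g -> regular (fun A => f A + g A)
| regular_mul f g : regular f -> regular g -> regular (fun A => f A * g A).

Definition simconj (g : sl3) (A : GG) : GG :=
  ((g * A.1 * g^-1)%g, (g * A.2 * g^-1)%g).

Definition cx_pred : {pred (GG -> K)} :=
  fun f => `[< regular f /\ forall g A, f (simconj g A) = f A >].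

Record CX := Cx { cx_fun :> GG -> K; cxP : cx_fun \in cx_pred }.
HB.instance Definition _ := [isSub for cx_fun].
HB.instance Definition _ := [Choice of CX by <:].

Lemma cxE f : reflect (regular f /\ forall g A, f (simconj g A) = f A)
  (f \in cx_pred).
Proof. exact: asboolP. Qed.

Fact cx_subring : subring_closed cx_pred.
Proof.
split; first by apply/cxE; split=> //; exact: (regular_cst 1).
- move=> f g /cxE[fr fi] /cxE[gr gi]; apply/cxE.
  have -> : f - g = fun A => f A + (fun A => -1 * g A) A.
    by apply/funext => A; rewrite mulN1r.
  split=> [|h A]; last by rewrite fi gi.
  by apply: regular_add => //; apply: regular_mul => //; exact: regular_cst.
- move=> f g /cxE[fr fi] /cxE[gr gi]; apply/cxE; split; first exact: regular_mul.
  by move=> h A; congr (_ * _).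
Qed.
HB.instance Definition _ :=
  GRing.SubChoice_isSubComPzRing.Build (GG -> K) cx_pred CX cx_subring.

Fact cx_scaleP (a : K) (f : CX) : (fun A => a * f A) \in cx_pred.
Proof.
have /cxE[fr fi] := cxP f; apply/cxE; split=> [|g A]; last by rewrite fi.
by apply: regular_mul => //; exact: regular_cst.
Qed.
Definition cx_scale (a : K) (f : CX) : CX := Cx (cx_scaleP a f).

Fact cx_scaleA a b f : cx_scale a (cx_scale b f) = cx_scale (a * b) f.
Proof. by apply: val_inj; apply/funext => A; exact: mulrA. Qed.
Fact cx_scale1 : left_id 1 cx_scale.
Proof. by move=> f; apply: val_inj; apply/funext => A; exact: mul1r. Qed.
Fact cx_scaleDr : right_distributive cx_scale +%R.
Proof. by move=> a f g; apply: val_inj; apply/funext => A; exact: mulrDr. Qed.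
Fact cx_scaleDl f : {morph cx_scale^~ f : a b / a + b}.
Proof. by move=> a b; apply: val_inj; apply/funext => A; exact: mulrDl. Qed.
HB.instance Definition _ := GRing.Zmodule_isLmodule.Build K CX
  cx_scaleA cx_scale1 cx_scaleDr cx_scaleDl.

Fact cx_neq0 : 1 != 0 :> CX.
Proof.
apply/eqP => /(congr1 (fun f : CX => f (1, 1)%g)) /eqP.
by rewrite (negPf (oner_neq0 K)).
Qed.
HB.instance Definition _ := GRing.PzSemiRing_isNonZero.Build CX cx_neq0.

Fact cx_scaleAl (a : K) (f g : CX) : a *: (f * g) = (a *: f) * g.
Proof. by apply: val_inj; apply/funext => A; exact: mulrA. Qed.
HB.instance Definition _ := GRing.Lmodule_isLalgebra.Build K CX cx_scaleAl.
HB.instance Definition _ := GRing.Lalgebra_isComAlgebra.Build K CX.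

Lemma regular_sum I (r : seq I) P (F : I -> GG -> K) :
  (forall i, regular (F i)) -> regular (fun A => \sum_(i <- r | P i) F i A).
Proof.
move=> Fr; elim: r => [|i r IH].
  by under eq_fun do rewrite big_nil; exact: regular_cst.
under eq_fun do rewrite big_cons; case: (P i) => //; exact: regular_add.
Qed.

Lemma regular_prod I (r : seq I) P (F : I -> GG -> K) :
  (forall i, regular (F i)) -> regular (fun A => \prod_(i <- r | P i) F i A).
Proof.
move=> Fr; elim: r => [|i r IH].
  by under eq_fun do rewrite big_nil; exact: regular_cst.
under eq_fun do rewrite big_cons; case: (P i) => //; exact: regular_mul.
Qed.

Lemma regular_comp f (F : GG -> GG) : regular f ->
  (forall i j, regular (fun A => sl3_mx (F A).1 i j)) ->
  (forall i j, regular (fun A => sl3_mx (F A).2 i j)) ->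
  regular (f \o F).
Proof.
move=> fr F1 F2; elim: fr => [c|||g h _ gr _ hr|g h _ gr _ hr] //.
- exact: regular_cst.
- exact: regular_add gr hr.
- exact: regular_mul gr hr.
Qed.

Lemma regular_letter l i j :
  regular (fun A : GG => sl3_mx (letter_ev A l) i j).
Proof.
case: l => [g []]; last first.
  case: g; rewrite /letter_ev /=; [exact: regular_snd | exact: regular_fst].
pose X (A : GG) : 'M[K]_3 := if g then A.2 else A.1.
have Xr i' j' : regular (fun A => X A i' j').
  by rewrite /X; case: g {X}; [exact: regular_snd | exact: regular_fst].
have E A : sl3_mx (letter_ev A (g, true)) i j = \adj (X A) i j.
  rewrite /letter_ev /X /=; case: g {X Xr} => /=; rewrite /invmx sl3_unit.
    by rewrite (eqP (sl3P A.2)) invr1 scale1r.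
  by rewrite (eqP (sl3P A.1)) invr1 scale1r.
under eq_fun do rewrite E mxE /cofactor /determinant.
apply: regular_mul; first exact: regular_cst.
apply: regular_sum => s; apply: regular_mul; first exact: regular_cst.
by apply: regular_prod => k; under eq_fun do rewrite !mxE; exact: Xr.
Qed.

Lemma regular_word (w : F2) i j :
  regular (fun A : GG => sl3_mx (word_ev A w) i j).
Proof.
rewrite /word_ev; elim: (word w) i j => [|l v IH] i j /=.
  exact: regular_cst.
under eq_fun do rewrite mxE.
by apply: regular_sum => k; apply: regular_mul => //; exact: regular_letter.
Qed.

Lemma simconj_word g A w : word_ev (simconj g A) w = (g * word_ev A w * g^-1)%g.
Proof.
pose f w := (g * word_ev A w * g^-1)%g.
have fM : {morph f : u v / (u * v)%g >-> (u * v)%g}.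
  by move=> u v; rewrite /f word_evM !mulgA mulgVK.
by rewrite -/(f w) (word_ev_uniq fM) /f word_ev1 word_ev2.
Qed.

Fact trw_subproof (w : F2) :
  (fun A : GG => \tr (sl3_mx (word_ev A w))) \in cx_pred.
Proof.
apply/cxE; split; first by apply: regular_sum => i; exact: regular_word.
move=> g A; rewrite simconj_word /= mxtrace_mulC mulmxA mulVmx ?sl3_unit //.
by rewrite mul1mx.
Qed.

(* trw w = tr(w), the trace of the word w evaluated at the two matrices *)
Definition trw (w : F2) : CX := Cx (trw_subproof w).

Definition pull (a : autg F2) (A : GG) : GG :=
  (word_ev A (a x1), word_ev A (a x2)).

Lemma word_ev_pull a A w : word_ev (pull a A) w = word_ev A (a w).
Proof.
rewrite /pull -(word_ev_uniq (f := word_ev A \o a)) //.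
by move=> u v /=; rewrite autgM word_evM.
Qed.

Fact aut_act_subproof (a : autg F2) (f : CX) : cx_fun f \o pull a \in cx_pred.
Proof.
have /cxE[fr fi] := cxP f; apply/cxE; split.
  by apply: regular_comp => //= i j; exact: regular_word.
by move=> g A; rewrite /= -[RHS](fi g) /pull !simconj_word.
Qed.

Definition aut_act (a : autg F2) (f : CX) : CX := Cx (aut_act_subproof a f).

(* the action of Out(F_2); inner automorphisms act trivially by [out_actE] *)
Definition out_act (s : outg F2) (f : CX) : CX := aut_act (repr s) f.

Lemma aut_act_inng x f : aut_act (inng x) f = f.
Proof.
have /cxE[_ fi] := cxP f; apply: val_inj; apply/funext => A /=.
rewrite -[RHS](fi (word_ev A x)); congr (cx_fun f (_, _));
  by rewrite /= !word_evM word_evV ?word_ev1 ?word_ev2.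
Qed.

Lemma aut_actM a b f : aut_act (a * b)%g f = aut_act a (aut_act b f).
Proof.
apply: val_inj; apply/funext => A /=; congr (cx_fun f (_, _));
  by rewrite word_ev_pull.
Qed.

Lemma out_actE a f : out_act (outc a) f = aut_act a f.
Proof.
by rewrite /out_act; have [x ->] := outc_repr a; rewrite aut_actM aut_act_inng.
Qed.

Lemma out_actM s t f : out_act (s * t)%g f = out_act s (out_act t f).
Proof.
by rewrite -(outcK s) -(outcK t) -outcM !out_actE aut_actM.
Qed.

Lemma out_act_trw a w : out_act (outc a) (trw w) = trw (a w).
Proof.
by rewrite out_actE; apply: val_inj; apply/funext => A /=; rewrite word_ev_pull.
Qed.

Fact out_act_linear s : linear (out_act s).
Proof. by move=> c f g; apply: val_inj; apply/funext. Qed.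
HB.instance Definition _ s :=
  GRing.isLinear.Build K CX CX *:%R (out_act s) (out_act_linear s).

Fact out_act_monoid s : monoid_morphism (out_act s).
Proof. by split=> [|f g]; apply: val_inj; apply/funext. Qed.
HB.instance Definition _ s :=
  GRing.isMonoidMorphism.Build CX CX (out_act s) (out_act_monoid s).

(* Elements of the group ring K D are written as coefficient functions on
   Out(F_2) vanishing outside D, which is finite by [finite_frakD]. *)
Definition grp_elt (s : outg F2) : outg F2 -> K := fun t => (t == s)%:R.

Definition grpring_act (c : outg F2 -> K) (f : CX) : CX :=
  \sum_(s \in [set: outg F2]) c s *: out_act s f.

Definition symD : outg F2 -> K := \sum_(s \in frakD) grp_elt s.

Lemma symDE s : symD s = (s \in frakD)%:R.
Proof.
rewrite /symD fsbig_finite; last exact: finite_frakD.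
rewrite (big_morph (fun c : outg F2 -> K => c s) (id1 := 0) (op1 := +%R)) //.
rewrite /grp_elt.
have E : (s \in fset_set frakD) = (s \in frakD).
  by rewrite in_fset_set //; exact: finite_frakD.
rewrite -E; case: (boolP (s \in fset_set frakD)) => [sD|sD]; last first.
  rewrite big_seq big1 // => t tD.
  by rewrite (negPf _ : (s == t) = false) //; apply: contraNneq sD => ->.
rewrite (bigD1_seq s) ?fset_uniq //= eqxx big1 ?addr0 // => t.
by rewrite eq_sym => /negPf->.
Qed.

Lemma grpring_act_symD f : grpring_act symD f = \sum_(s \in frakD) out_act s f.
Proof.
rewrite /grpring_act -(@fsbig_widen _ _ 0 _ frakD) //.
  by apply: eq_fsbigr => s sD; rewrite symDE sD scale1r.
by move=> s [_ sD] /=; rewrite symDE memNset // scale0r.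
Qed.

(* tk is t_(k) and tmk is t_(-k) *)
Definition t1 : CX := trw x1.
Definition tm1 : CX := trw x1^-1%g.
Definition t2 : CX := trw x2.
Definition tm2 : CX := trw x2^-1%g.
Definition t3 : CX := trw (x1 * x2)%g.
Definition tm3 : CX := trw (x1^-1 * x2^-1)%g.
Definition t4 : CX := trw (x1 * x2^-1)%g.
Definition tm4 : CX := trw (x1^-1 * x2)%g.

Definition bigP : CX :=
  t1 * tm1 * t2 * tm2 - t1 * t2 * tm3 - tm1 * tm2 * t3 - t1 * tm2 * tm4
  - tm1 * t2 * t4 + t1 * tm1 + t2 * tm2 + t3 * tm3 + t4 * tm4 - 3.

Definition bigQ : CX :=
  9 - 6 * t1 * tm1 - 6 * t2 * tm2 - 6 * t3 * tm3 - 6 * t4 * tm4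
  + t1 ^+ 3 + t2 ^+ 3 + t3 ^+ 3 + t4 ^+ 3 + tm1 ^+ 3 + tm2 ^+ 3
  + tm3 ^+ 3 + tm4 ^+ 3 - 3 * tm4 * tm3 * tm1 - 3 * t4 * t3 * t1
  - 3 * tm4 * t2 * t3 - 3 * t4 * tm2 * tm3 + 3 * tm4 * tm2 * t1
  + 3 * t4 * t2 * tm1 + 3 * t1 * t2 * tm3 + 3 * tm1 * tm2 * t3
  + tm2 * tm1 * t2 * t1 + tm3 * tm2 * t3 * t2 + tm4 * tm1 * t4 * t1
  + tm4 * tm2 * t4 * t2 + tm3 * tm1 * t3 * t1 + tm3 * tm4 * t3 * t4
  + tm4 ^+ 2 * tm3 * tm2 + t4 ^+ 2 * t3 * t2 + tm1 ^+ 2 * tm2 * tm4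
  + t1 ^+ 2 * t2 * t4 + t1 * tm2 ^+ 2 * tm3 + tm1 * t2 ^+ 2 * t3
  + tm4 * tm3 * t1 ^+ 2 + t4 * t3 * tm1 ^+ 2 + tm4 * t2 * tm3 ^+ 2
  + t4 * tm2 * t3 ^+ 2 + tm1 ^+ 2 * tm3 * t2 + t1 ^+ 2 * t3 * tm2
  + tm4 * t1 * t2 ^+ 2 + t4 * tm1 * tm2 ^+ 2 + tm4 * t3 * tm2 ^+ 2
  + t4 * tm3 * t2 ^+ 2 + t1 * t3 * tm4 ^+ 2 + tm1 * tm3 * t4 ^+ 2
  + tm1 * tm4 * t3 ^+ 2 + t1 * t4 * tm3 ^+ 2 - 2 * tm3 ^+ 2 * tm2 * tm1
  - 2 * t3 ^+ 2 * t2 * t1 - 2 * tm4 ^+ 2 * tm1 * t2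
  - 2 * t4 ^+ 2 * t1 * tm2 + tm1 ^+ 2 * tm2 ^+ 2 * tm3
  + t1 ^+ 2 * t2 ^+ 2 * t3 + tm4 * tm1 ^+ 2 * t2 ^+ 2
  + t4 * t1 ^+ 2 * tm2 ^+ 2 - tm4 * tm2 ^+ 2 * t2 * t1
  - t4 * t2 ^+ 2 * tm2 * tm1 - tm3 * t1 ^+ 2 * tm1 * t2
  - t3 * tm1 ^+ 2 * t1 * tm2 - tm3 * t2 ^+ 2 * tm2 * t1
  - t3 * tm2 ^+ 2 * t2 * tm1 - tm4 * tm2 * tm1 * t1 ^+ 2
  - t4 * t2 * t1 * tm1 ^+ 2 - tm1 * tm2 ^+ 3 * t1 - tm1 * t2 ^+ 3 * t1
  - tm1 ^+ 3 * tm2 * t2 - t1 ^+ 3 * tm2 * t2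
  - tm4 * tm3 * tm2 * tm1 * t2 - t4 * t3 * t2 * t1 * tm2
  - tm1 * t1 * t2 * tm4 * t3 - tm1 * t1 * tm2 * t4 * tm3
  + tm2 * tm1 ^+ 2 * t1 ^+ 2 * t2 + tm1 * tm2 ^+ 2 * t2 ^+ 2 * t1.

Definition smallp : CX :=
  (8^-1 : K) *:
  (t1 * tm1 * t2 * tm2 - 4 * t1 * tm2 * tm4 + 2 * t1 * tm1 + 2 * t3 * tm3).

Definition smallq : CX :=
  (8^-1 : K) *:
  (2 * tm2 * tm1 ^+ 2 * t1 ^+ 2 * t2 + 4 * t1 ^+ 2 * t2 ^+ 2 * t3
   - 4 * t1 ^+ 3 * tm2 * t2 - 8 * tm4 * tm2 * tm1 * t1 ^+ 2
   - 4 * t4 * t3 * t2 * t1 * tm2 + 8 * t1 * t3 * tm4 ^+ 2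
   + 8 * tm4 * t1 * t2 ^+ 2 - 8 * t3 ^+ 2 * t2 * t1
   + 4 * t4 * tm3 * t2 ^+ 2 + tm2 * tm1 * t2 * t1 + tm3 * tm4 * t3 * t4
   + 4 * tm3 * tm1 * t3 * t1 + 4 * t1 ^+ 3 + 4 * t3 ^+ 3
   + 12 * tm4 * tm2 * t1 - 12 * tm4 * t2 * t3 - 12 * t1 * tm1
   - 12 * t3 * tm3).

End CharacterVariety.

(* Main.v *)
Require Import Defs.
From mathcomp Require Import all_boot all_order all_algebra.
From mathcomp Require Import reals complex.
From mathcomp Require Import boolp classical_sets fsbigop.
From mathcomp Require Import ring.
Import GRing.Theory.
Local Open Scope ring_scope.
Local Open Scope complex_scope.

(** The group D is the dihedral group of order 8: its generators tau and iota
    are involutions satisfying the braid relation (tau iota)^2 = (iota tau)^2,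
    so every element is an alternating word of length at most 4 in them
    ([dihedral8_genE]).  These eight words are pairwise distinct in Out(F_2):
    sending x_1 to 1 and x_2 to 2 in the cyclic group of order 5 gives a
    homomorphism that ignores inner automorphisms and tells apart the letters
    x_1, x_1^-1, x_2, x_2^-1, hence the eight automorphisms ([uniq_dihedral8D]).
    The symmetrizer thus sends f to the sum of its eight images
    ([grpring_act_dihedral8]).

    Because the action is by algebra automorphisms, it is determined on
    polynomials in the t_(k) by the two permutations that tau and iota induce
    on these eight traces ([out_act_tau], [out_act_iota]).  Both formulas are
    then polynomial identities in eight independent variables, valid in every
    commutative ring once denominators are cleared ([grpring_act_p],
    [grpring_act_q]). *)

(** * Dihedral groups of order 8 *)

(** The alternating words of length at most 4 in s and t; when s and t are
    involutions with (s t)^2 = (t s)^2, these are all elements they generate. *)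
Definition dihedral8 {G : groupType} (s t : G) : seq G :=
  [:: 1; s; t; s * t; t * s; s * t * s; t * s * t; s * t * s * t]%g.

(** Left translation by either generator preserves the eight words. *)
Lemma dihedral8_mul {G : groupType} {s t u : G} :
  (s * s = 1)%g -> (t * t = 1)%g -> (s * t * s * t = t * s * t * s)%g ->
  u \in dihedral8 s t ->
  (s * u)%g \in dihedral8 s t /\ (t * u)%g \in dihedral8 s t.
Proof.
move=> ss tt st.
have sK v : (s * (s * v) = v)%g by rewrite mulgA ss mul1g.
have tK v : (t * (t * v) = v)%g by rewrite mulgA tt mul1g.
have stst : (t * (s * (t * s)) = s * (t * (s * t)))%g by rewrite !mulgA st.
have tsts : (t * (s * (t * (s * t))) = s * (t * s))%g.
  by rewrite !mulgA -st -!mulgA tt mulg1.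
rewrite !inE => /or4P[||| /or4P[||| /orP[]]] /eqP->;
  by rewrite -?mulgA ?mulg1 ?ss ?tt ?sK ?tK ?stst ?tsts ?eqxx ?orbT.
Qed.

Lemma dihedral8_genE {G : groupType} {s t : G} :
  (s * s = 1)%g -> (t * t = 1)%g -> (s * t * s * t = t * s * t * s)%g ->
  subgroup_gen [set s; t]%classic = [set` dihedral8 s t]%classic.
Proof.
move=> ss tt st; apply/seteqP; split=> [x|x].
  (* The elements x such that x and x^-1 both stabilize the list under left
     translation form a subgroup containing s and t. *)
  pose M : set G := [set x | forall u, u \in dihedral8 s t ->
    (x * u)%g \in dihedral8 s t /\ (x^-1 * u)%g \in dihedral8 s t]%classic.
  have sV : (s^-1 = s)%g by apply: (mulgI s); rewrite ss mulgV.
  have tV : (t^-1 = t)%g by apply: (mulgI t); rewrite tt mulgV.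
  have DM : (subgroup_gen [set s; t] `<=` M)%classic.
    apply: smallest_sub => [|y].
      split=> [u uD|y z My Mz u uD]; first by rewrite invg1 mul1g.
      rewrite invgM invgK -!mulgA; split.
        exact: (My _ (Mz _ uD).2).1.
      exact: (Mz _ (My _ uD).2).1.
    by case=> -> u uD; rewrite ?sV ?tV; have [] := dihedral8_mul ss tt st uD.
  move=> /DM/(_ 1%g); rewrite mulg1 => -[] //.
  by rewrite inE eqxx.
move=> xD H [[H1 HM] stH].
have HV y : H y -> H (y^-1)%g by move=> Hy; rewrite -[(_^-1)%g]mul1g; exact: HM.
have Hm y z : H y -> H z -> H (y * z)%g.
  by move=> Hy Hz; rewrite -(invgK z); apply: HM => //; exact: HV.
have Hs : H s by apply: stH; left.
have Ht : H t by apply: stH; right.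
move: xD; rewrite /= !inE => /or4P[||| /or4P[||| /orP[]]] /eqP-> //;
  by repeat apply Hm.
Qed.

(** * The group D inside Out(F_2) *)

Notation tau := (outc tau_aut).
Notation iota := (outc iota_aut).

Lemma autg_F2_eq (a b : autg F2) : a x1 = b x1 -> a x2 = b x2 -> a = b.
Proof.
move=> ab1 ab2; apply: autgP => w.
by rewrite (word_ev_uniq (@autgM _ a)) (word_ev_uniq (@autgM _ b)) ab1 ab2.
Qed.

Lemma tau_autE :
  [/\ tau_aut x1 = x2, tau_aut x2 = x1 &
      forall w, tau_aut (w^-1)%g = ((tau_aut w)^-1)%g].
Proof. by split=> [||w] /=; rewrite ?word_ev1 ?word_ev2 ?word_evV. Qed.

Lemma iota_autE :
  [/\ iota_aut x1 = (x1^-1)%g, iota_aut x2 = x2 &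
      forall w, iota_aut (w^-1)%g = ((iota_aut w)^-1)%g].
Proof. by split=> [||w] /=; rewrite ?word_ev1 ?word_ev2 ?word_evV. Qed.

Lemma frakDE : frakD = [set` dihedral8 tau iota]%classic.
Proof.
have [t1 t2 tV] := tau_autE; have [i1 i2 iV] := iota_autE.
have tt : (tau_aut * tau_aut = 1)%g.
  by apply: autg_F2_eq; rewrite !autg_mulE ?(t1, t2).
have ii : (iota_aut * iota_aut = 1)%g.
  by apply: autg_F2_eq; rewrite !autg_mulE ?(i1, i2, iV, invgK).
have ti : (tau_aut * iota_aut * tau_aut * iota_aut =
           iota_aut * tau_aut * iota_aut * tau_aut)%g.
  by apply: autg_F2_eq; rewrite !autg_mulE ?(t1, t2, tV, i1, i2, iV, invgK).
apply: dihedral8_genE; first by rewrite -outcM tt.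
  by rewrite -outcM ii.
by move: (congr1 (@outc F2) ti); rewrite !outcM.
Qed.

(** The residues mod 5 of the images of x_1 and x_2 under an automorphism,
    when x_1 and x_2 are given the residues 1 and 2. *)
Definition residue (w : F2) : 'Z_5 := word_ev (1 : 'Z_5, 2%:R : 'Z_5) w.
Definition residues (a : autg F2) := (residue (a x1), residue (a x2)).

Lemma residues_out {a b : autg F2} :
  outc a = outc b -> residues a = residues b.
Proof.
move=> /eqP/outcP[x ->]; rewrite /residues !autg_mulE /=.
have E y : residue (x * y * x^-1)%g = residue y.
  (* The residues form a commutative group, so conjugation is invisible. *)
  by rewrite /residue !word_evM word_evV Zp_mulgC mulKg.
by rewrite !E.
Qed.

Lemma residueV (w : F2) : residue (w^-1)%g = - residue w.
Proof. exact: word_evV. Qed.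

Lemma uniq_dihedral8D : uniq (dihedral8 tau iota).
Proof.
pose L := dihedral8 tau_aut iota_aut.
have -> : dihedral8 tau iota = map (@outc F2) L by rewrite /= !outcM.
have uL : uniq (map residues L).
  have [t1 t2 tV] := tau_autE; have [i1 i2 iV] := iota_autE.
  have r1 : residue x1 = 1 by exact: word_ev1.
  have r2 : residue x2 = 2%:R by exact: word_ev2.
  rewrite /L /dihedral8 8!map_cons /residues !autg_mulE.
  by rewrite ?(t1, t2, tV, i1, i2, iV, invgK, residueV, r1, r2).
(* [residues] factors through Out(F_2), so it separates the outer classes. *)
apply: (map_uniq (f := residues \o repr)); rewrite -map_comp.
rewrite (@eq_map _ _ _ residues) // => a /=.
by apply: residues_out; rewrite outcK.
Qed.

(** * The action of D on the traces *)

Section Action.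
Variable K : fieldType.
Implicit Types (f : CX K).

Lemma grpring_act_dihedral8 f :
  grpring_act (symD K) f = \sum_(s <- dihedral8 tau iota) out_act s f.
Proof. by rewrite grpring_act_symD frakDE -fsbig_seq ?uniq_dihedral8D. Qed.

(** Traces of words are invariant under cyclic permutation. *)
Lemma trwC (u v : F2) : trw K (u * v)%g = trw K (v * u)%g.
Proof.
by apply: val_inj; apply/funext => A /=; rewrite !word_evM /= mxtrace_mulC.
Qed.

Lemma out_act_tau :
  [/\ out_act tau (t1 K) = t2 K, out_act tau (tm1 K) = tm2 K,
      out_act tau (t2 K) = t1 K & out_act tau (tm2 K) = tm1 K] /\
  [/\ out_act tau (t3 K) = t3 K, out_act tau (tm3 K) = tm3 K,
      out_act tau (t4 K) = tm4 K & out_act tau (tm4 K) = t4 K].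
Proof.
have [t1 t2 tV] := tau_autE.
split; split; rewrite out_act_trw ?autgM ?tV ?t1 ?t2 //; exact: trwC.
Qed.

Lemma out_act_iota :
  [/\ out_act iota (t1 K) = tm1 K, out_act iota (tm1 K) = t1 K,
      out_act iota (t2 K) = t2 K & out_act iota (tm2 K) = tm2 K] /\
  [/\ out_act iota (t3 K) = tm4 K, out_act iota (tm3 K) = t4 K,
      out_act iota (t4 K) = tm3 K & out_act iota (tm4 K) = t3 K].
Proof.
have [i1 i2 iV] := iota_autE.
by split; split; rewrite out_act_trw ?autgM ?iV ?i1 ?i2 ?invgK.
Qed.


Lemma out_act1 f : out_act 1%g f = f.
Proof. by rewrite out_actE -inng1 aut_act_inng. Qed.

(** The symmetrizer applied to F(t_(1), t_(-1), ..., t_(4), t_(-4)), for an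
    operation F commuting with the action: the eight terms permute the
    arguments according to the elements listed in [dihedral8]. *)
Lemma grpring_act_equivariant
    (F : CX K -> CX K -> CX K -> CX K -> CX K -> CX K -> CX K -> CX K -> CX K) :
  (forall s a a' b b' c c' d d', out_act s (F a a' b b' c c' d d') =
     F (out_act s a) (out_act s a') (out_act s b) (out_act s b')
       (out_act s c) (out_act s c') (out_act s d) (out_act s d')) ->
  let: (a, a', b, b') := (t1 K, tm1 K, t2 K, tm2 K) in
  let: (c, c', d, d') := (t3 K, tm3 K, t4 K, tm4 K) in
  grpring_act (symD K) (F a a' b b' c c' d d') =
    F a a' b b' c c' d d' + F b b' a a' c c' d' d
    + F a' a b b' d' d c' c + F b' b a a' d d' c' c
    + F b b' a' a d' d c c' + F a a' b' b d d' c c'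
    + F b' b a' a c' c d d' + F a' a b' b c' c d' d.
Proof.
move=> FE.
have [[T1 Tm1 T2 Tm2] [T3 Tm3 T4 Tm4]] := out_act_tau.
have [[I1 Im1 I2 Im2] [I3 Im3 I4 Im4]] := out_act_iota.
rewrite grpring_act_dihedral8 /dihedral8 !big_cons big_nil !out_actM out_act1.
do 4!rewrite ?FE ?T1 ?Tm1 ?T2 ?Tm2 ?T3 ?Tm3 ?T4 ?Tm4
  ?I1 ?Im1 ?I2 ?Im2 ?I3 ?Im3 ?I4 ?Im4.
by rewrite addr0 !addrA.
Qed.

End Action.

(** * The two symmetrizations *)

(** 8 p and 8 q as polynomial expressions in arbitrary elements a, a', b, b',
    c, c', d, d' standing for t_(1), t_(-1), t_(2), t_(-2), t_(3), t_(-3),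
    t_(4), t_(-4). *)
Definition poly_p {S : pzRingType} (a a' b b' c c' d d' : S) : S :=
  a * a' * b * b' - 4 * a * b' * d' + 2 * a * a' + 2 * c * c'.

Definition poly_q {S : pzRingType} (a a' b b' c c' d d' : S) : S :=
  2 * b' * a' ^+ 2 * a ^+ 2 * b + 4 * a ^+ 2 * b ^+ 2 * c
   - 4 * a ^+ 3 * b' * b - 8 * d' * b' * a' * a ^+ 2
   - 4 * d * c * b * a * b' + 8 * a * c * d' ^+ 2
   + 8 * d' * a * b ^+ 2 - 8 * c ^+ 2 * b * a
   + 4 * d * c' * b ^+ 2 + b' * a' * b * a + c' * d' * c * d
   + 4 * c' * a' * c * a + 4 * a ^+ 3 + 4 * c ^+ 3
   + 12 * d' * b' * a - 12 * d' * b * c - 12 * a * a'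
   - 12 * c * c'.

Section Symmetrization.
Variable K : fieldType.

Lemma out_act_p s (a a' b b' c c' d d' : CX K) :
  out_act s (poly_p a a' b b' c c' d d') =
  poly_p (out_act s a) (out_act s a') (out_act s b) (out_act s b')
         (out_act s c) (out_act s c') (out_act s d) (out_act s d').
Proof. by rewrite /poly_p !(rmorph_nat, rmorphXn, rmorphB, rmorphD, rmorphM). Qed.

Lemma out_act_q s (a a' b b' c c' d d' : CX K) :
  out_act s (poly_q a a' b b' c c' d d') =
  poly_q (out_act s a) (out_act s a') (out_act s b) (out_act s b')
         (out_act s c) (out_act s c') (out_act s d) (out_act s d').
Proof. by rewrite /poly_q !(rmorph_nat, rmorphXn, rmorphB, rmorphD, rmorphM). Qed.

Lemma grpring_act_p :
  grpring_act (symD K)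
    (poly_p (t1 K) (tm1 K) (t2 K) (tm2 K) (t3 K) (tm3 K) (t4 K) (tm4 K))
  = 8 * (bigP K + 3).
Proof.
rewrite (grpring_act_equivariant K _ out_act_p) /bigP /poly_p.
move: (t1 K) (tm1 K) (t2 K) (tm2 K) (t3 K) (tm3 K) (t4 K) (tm4 K).
by move=> a a' b b' c c' d d'; ring.
Qed.

Lemma grpring_act_q :
  grpring_act (symD K)
    (poly_q (t1 K) (tm1 K) (t2 K) (tm2 K) (t3 K) (tm3 K) (t4 K) (tm4 K))
  = 8 * (bigQ K - 9).
Proof.
rewrite (grpring_act_equivariant K _ out_act_q) /bigQ /poly_q.
move: (t1 K) (tm1 K) (t2 K) (tm2 K) (t3 K) (tm3 K) (t4 K) (tm4 K).
by move=> a a' b b' c c' d d'; ring.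
Qed.

Lemma grpring_act_symDZ (k : K) (f : CX K) :
  grpring_act (symD K) (k *: f) = k *: grpring_act (symD K) f.
Proof.
rewrite !grpring_act_dihedral8 scaler_sumr.
by apply: eq_bigr => s _; rewrite linearZ.
Qed.

Lemma scale_inv8K (f : CX K) : (8 : K) != 0 -> 8^-1 *: (8 * f) = f.
Proof.
by move=> n8; rewrite mulr_natl -scaler_nat scalerA mulVf ?scale1r.
Qed.

End Symmetrization.

(* R[i], for a realType R, is the field of complex numbers. *)
Theorem corollary3p5p3 (R : realType) :
  bigP R[i] = grpring_act (symD R[i]) (smallp R[i]) - 3 /\
  bigQ R[i] = grpring_act (symD R[i]) (smallq R[i]) + 9.
Proof.
have n8 : (8 : R[i]) != 0 by rewrite Num.Theory.pnatr_eq0.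
by rewrite !grpring_act_symDZ grpring_act_p grpring_act_q !scale_inv8K // addrK subrK.
Qed.
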